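(* Consider the problem $\min_x f(x)=\frac1n\sum_{i=1}^n f_i(x)$ with $f$ $\mu$-strongly convex and unique minimizer $x^*$, run Algorithm BL1 (described in the context), and suppose the constants $H,H_1,M_1,M_2,R$ of the context satisfy the stated inequalities. (i) Suppose each $\mathcal{Q}^k$ is an unbiased compressor with parameter $\omega_{\rm M}$, $0<\eta\le1/(\omega_{\rm M}+1)$; for all $j\in[d]$ and $k\ge0$, $(z^k)_j$ is a convex combination of $\{(x^t)_j\}_{t=0}^k$; and for all $i\in[n]$, $j,l\in[d]$, $k\ge0$, $(\mathbf{L}_i^k)_{jl}$ is a convex combination of $\{h^i(\nabla^2f_i(z^t))_{jl}\}_{t=0}^k$. If $\|x^0-x^*\|^2\le\tilde c_1:=\min\left\{\frac{\mu^2}{4d^2H^2},\frac{\mu^2}{16d^4N_{\rm B}R^2M_2^2}\right\}$, then $\|z^k-x^*\|^2\le d\,\tilde c_1$ and $\mathcal{H}^k\le\frac{\mu^2}{16dN_{\rm B}R^2}$ for all $k\ge0$. (ii) Suppose each $\mathcal{Q}^k$ is a deterministic contraction compressor with parameter $\delta_{\rm M}$ and $\eta=1$, and each $\mathcal{C}_i^k$ is a deterministic contraction compressor with parameter $\delta$ and $\alpha=1$; set $(A_{\rm M},B_{\rm M}):=(\delta_{\rm M}/4,6/\delta_{\rm M}-7/2)$ and $(A,B):=(\delta/4,6/\delta-7/2)$. If $\|z^0-x^*\|^2\le\tilde c_2:=\min\left\{\frac{A_{\rm M}\mu^2}{4H^2B_{\rm M}},\frac{AA_{\rm M}\mu^2}{16N_{\rm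 B}R^2B_{\rm M}BM_1^2}\right\}$ and $\mathcal{H}^0\le\frac{A_{\rm M}\mu^2}{16N_{\rm B}R^2B_{\rm M}}$, then $\|z^k-x^*\|^2\le\tilde c_2$ and $\mathcal{H}^k\le\frac{A_{\rm M}\mu^2}{16N_{\rm B}R^2B_{\rm M}}$ for all $k\ge0$.
   Context: Compressors: a randomized map on $\mathbb{R}^{d\times d}$ (or $\mathbb{R}^d$) is unbiased with parameter $\omega\ge0$ if $\mathbb{E}\mathcal{C}(\mathbf{A})=\mathbf{A}$ and $\mathbb{E}\|\mathcal{C}(\mathbf{A})\|_{\rm F}^2\le(\omega+1)\|\mathbf{A}\|_{\rm F}^2$; a contraction compressor with parameter $\delta\in(0,1]$ if $\mathbb{E}\|\mathbf{A}-\mathcal{C}(\mathbf{A})\|_{\rm F}^2\le(1-\delta)\|\mathbf{A}\|_{\rm F}^2$; deterministic means $\mathcal{C}$ is a fixed (non-random) map. Bases: for each $i\in[n]$, $\{\mathbf{B}_i^{jl}\}_{j,l\in[d]}$ is a basis of $\mathbb{R}^{d\times d}$ and $h^i(\mathbf{A})$ is the coefficient matrix with $\mathbf{A}=\sum_{j,l}h^i(\mathbf{A})_{jl}\mathbf{B}_i^{jl}$; $N_{\rm B}:=1$ if all these bases are Frobenius-orthogonal, else $N_{\rm B}:=d^2$. Standing assumptions: for all $x,y$, $i$: $\|\nabla^2f_i(x)-\nabla^2f_i(y)\|\le H\|x-y\|$ (spectral), $\|\nabla^2f_i(x)-\nabla^2f_i(y)\|_{\rm F}\le H_1\|x-y\|$,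 $\|h^i(\nabla^2f_i(x))-h^i(\nabla^2f_i(y))\|_{\rm F}\le M_1\|x-y\|$, $\max_{j,l}|h^i(\nabla^2f_i(x))_{jl}-h^i(\nabla^2f_i(y))_{jl}|\le M_2\|x-y\|$, $\max_{j,l}\|\mathbf{B}_i^{jl}\|_{\rm F}\le R$. $[\mathbf{A}]_\mu$ is the Frobenius projection onto $\{\mathbf{A}=\mathbf{A}^\top,\mathbf{A}\succeq\mu\mathbf{I}\}$. Algorithm BL1 (parameters $\alpha,\eta\ge0$, $p\in(0,1]$): initialize $x^0=w^0=z^0$, matrices $\mathbf{L}_i^0$, $\xi^0=1$; $\mathbf{H}_i^k:=\sum_{j,l}(\mathbf{L}_i^k)_{jl}\mathbf{B}_i^{jl}$, $\mathbf{H}^k:=\frac1n\sum_i\mathbf{H}_i^k$. At iteration $k$: if $\xi^k=1$, $w^{k+1}=z^k$, $g^k=\nabla f(z^k)$; if $\xi^k=0$, $w^{k+1}=w^k$, $g^k=[\mathbf{H}^k]_\mu(z^k-w^k)+\nabla f(w^k)$. $\mathbf{L}_i^{k+1}=\mathbf{L}_i^k+\alpha\,\mathcal{C}_i^k(h^i(\nabla^2f_i(z^k))-\mathbf{L}_i^k)$; $x^{k+1}=z^k-[\mathbf{H}^k]_\mu^{-1}g^k$; $z^{k+1}=z^k+\eta\mathcal{Q}^k(x^{k+1}-z^k)$; $\xi^{k+1}\sim$ Bernoulli$(p)$. $\mathbf{L}_i^*:=h^i(\nabla^2f_i(x^* ))$, $\mathcal{H}^k:=\frac1n\sum_i\|\mathbf{L}_i^k-\mathbf{L}_i^*\|_{\rm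 F}^2$. *)

(* Defs.v *)
From HB Require Import structures.
From mathcomp Require Import all_boot all_order all_algebra.
From mathcomp Require Import all_classical all_reals all_analysis.
Set Implicit Arguments. Unset Strict Implicit. Unset Printing Implicit Defensive.
Import Order.TTheory GRing.Theory Num.Theory.
Import numFieldNormedType.Exports.
Local Open Scope classical_set_scope.
Local Open Scope ring_scope.

Section BL1.
Variables (R : realType) (d n : nat).

Notation vec := 'cV[R]_d.
Notation mat := 'M[R]_d.

Definition sqnorm (v : vec) : R := \sum_(j < d) v j 0 ^+ 2.
Definition vnorm (v : vec) : R := Num.sqrt (sqnorm v).
Definition frob2 (A : mat) : R := \sum_(a < d) \sum_(b < d) A a b ^+ 2.
Definition frobdot (A B : mat) : R := \sum_(a < d) \sum_(b < d) A a b * B a b.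

Definition opnorm_le (A : mat) (c : R) : Prop :=
  0 <= c /\ forall v : vec, sqnorm (A *m v) <= c ^+ 2 * sqnorm v.

Definition has_grad (f : vec -> R) (g : vec -> vec) : Prop :=
  forall x v : vec, is_derive x v f (((g x)^T *m v) 0 0).
Definition has_hess (g : vec -> vec) (Hs : vec -> mat) : Prop :=
  forall x v : vec, is_derive x v g (Hs x *m v).

Definition strongly_convex (mu : R) (f : vec -> R) : Prop :=
  forall (x y : vec) (t : R), 0 <= t <= 1 ->
    f (t *: x + (1 - t) *: y) <=
      t * f x + (1 - t) * f y - mu / 2 * t * (1 - t) * sqnorm (x - y).

Definition symmetric (A : mat) : Prop := A^T = A.
Definition psd_ge (A : mat) (mu : R) : Prop :=
  forall v : vec, mu * sqnorm v <= (v^T *m A *m v) 0 0.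

Definition is_proj_mu (mu : R) (A P : mat) : Prop :=
  symmetric P /\ psd_ge P mu /\
  forall Q : mat, symmetric Q -> psd_ge Q mu -> frob2 (A - P) <= frob2 (A - Q).

Definition is_coord (B : 'I_d -> 'I_d -> mat) (h : mat -> mat) : Prop :=
  (forall A : mat, A = \sum_(j < d) \sum_(l < d) h A j l *: B j l) /\
  (forall c : mat, \sum_(j < d) \sum_(l < d) c j l *: B j l = 0 -> c = 0).

Definition frob_orthogonal_basis (B : 'I_d -> 'I_d -> mat) : Prop :=
  forall j l j' l' : 'I_d, (j, l) != (j', l') -> frobdot (B j l) (B j' l') = 0.

Definition NB (B : 'I_n -> 'I_d -> 'I_d -> mat) : R :=
  if `[< forall i, frob_orthogonal_basis (B i) >] then 1 else (d ^ 2)%:R.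

Definition favg (fi : 'I_n -> vec -> R) (x : vec) : R := n%:R^-1 * \sum_i fi i x.
Definition gavg (g : 'I_n -> vec -> vec) (x : vec) : vec := n%:R^-1 *: \sum_i g i x.

Definition Hmat (B : 'I_n -> 'I_d -> 'I_d -> mat) (L : 'I_n -> mat) : mat :=
  n%:R^-1 *: \sum_i \sum_(j < d) \sum_(l < d) L i j l *: B i j l.

Definition Hcal (L Lstar : 'I_n -> mat) : R :=
  n%:R^-1 * \sum_i frob2 (L i - Lstar i).

Definition state := (vec * vec * vec * ('I_n -> mat) * bool)%type.
Definition st_x (s : state) : vec := s.1.1.1.1.
Definition st_w (s : state) : vec := s.1.1.1.2.
Definition st_z (s : state) : vec := s.1.1.2.
Definition st_L (s : state) : 'I_n -> mat := s.1.2.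
Definition st_xi (s : state) : bool := s.2.

(* one iteration of BL1, given the realizations of Q^k, C_i^k and xi^{k+1} *)
Definition bl1_step (g : 'I_n -> vec -> vec) (hs : 'I_n -> vec -> mat)
  (B : 'I_n -> 'I_d -> 'I_d -> mat) (h : 'I_n -> mat -> mat)
  (proj : mat -> mat) (alpha eta : R)
  (s : state) (Qk : vec -> vec) (Ck : 'I_n -> mat -> mat) (xinext : bool)
  : state :=
  let x := st_x s in let w := st_w s in let z := st_z s in
  let L := st_L s in let xi := st_xi s in
  let HP := proj (Hmat B L) in
  let w' := if xi then z else w in
  let gk := if xi then gavg g z else HP *m (z - w) + gavg g w in
  let L' := fun i => L i + alpha *: Ck i (h i (hs i z) - L i) in
  let x' := z - invmx HP *m gk in
  let z' := z + eta *: Qk (x' - z) in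
  (x', w', z', L', xinext).

Fixpoint bl1 (g : 'I_n -> vec -> vec) (hs : 'I_n -> vec -> mat)
  (B : 'I_n -> 'I_d -> 'I_d -> mat) (h : 'I_n -> mat -> mat)
  (proj : mat -> mat) (alpha eta : R) (x0 : vec) (L0 : 'I_n -> mat)
  (Q : nat -> vec -> vec) (C : nat -> 'I_n -> mat -> mat) (xi : nat -> bool)
  (k : nat) : state :=
  match k with
  | 0 => (x0, x0, x0, L0, true)
  | k'.+1 => bl1_step g hs B h proj alpha eta
               (bl1 g hs B h proj alpha eta x0 L0 Q C xi k') (Q k') (C k') (xi k)
  end.

End BL1.

(* Main.v *)
Require Import Defs.
From HB Require Import structures.
From mathcomp Require Import all_boot all_order all_algebra.
From mathcomp Require Import all_classical all_reals all_analysis.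
From mathcomp Require Import ring lra.
Import Order.TTheory GRing.Theory Num.Theory.
Import numFieldNormedType.Exports.
Local Open Scope classical_set_scope.
Local Open Scope ring_scope.
Set Implicit Arguments. Unset Strict Implicit. Unset Printing Implicit Defensive.

(** Write [w'] for the anchor after a step and [P] for the projected Hessian
    estimate.  Whatever the Bernoulli variable is,
    [x' - xs = (w' - xs) - P^-1 grad f(w')] for the minimizer [xs], so that
    [mu |x' - xs| <= |P - Hs|_F |w' - xs| + |grad f(w') - Hs (w' - xs)|] with
    [Hs] the Hessian of [f] at [xs].  Since [Hs] is symmetric and at least [mu],
    projecting does not increase the distance to it, so the first term is
    controlled by [N_B R^2] times the error of the coefficients [L_i]; the second
    one is at most [H |w' - xs|^2].  The resulting quadratic inequality keeps the
    iterates in a ball: in (i) because [z^k] and [L_i^k] are coordinatewise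
    averages of past values, in (ii) because a contraction compressor satisfies
    [|z' - xs|^2 <= (1 - A_M) |z - xs|^2 + B_M |x' - xs|^2], and likewise for the
    [L_i].  Both parts hold for every realization, so no expectation is used. *)

(** * Inequalities for finite sums of squares *)

Section SumOfSquares.
Variables (R : realType) (I : finType).
Implicit Types (u v a b e : I -> R).

Lemma sumsq_ge0 u : 0 <= \sum_i u i ^+ 2.
Proof. by apply: sumr_ge0 => i _; exact: sqr_ge0. Qed.

(** The sum of [(b * u i - c * v i) ^+ 2] expands to [b * (b * a - c ^+ 2)], where [a] and [b] are
    the two sums of squares and [c] is the inner product. Dividing by [b] requires the case [b = 0]
    apart. *)
Lemma cauchy_schwarz_sum u v :
  (\sum_i u i * v i) ^+ 2 <= (\sum_i u i ^+ 2) * (\sum_i v i ^+ 2).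
Proof.
set c := \sum_i u i * v i; set a := \sum_i u i ^+ 2; set b := \sum_i v i ^+ 2.
have b0 : 0 <= b by exact: sumsq_ge0.
have [b_eq0|b_neq0] := eqVneq b 0.
  suff -> : c = 0 by rewrite b_eq0 mulr0 expr0n.
  rewrite /c big1// => i _.
  have /eqP : v i ^+ 2 = 0 by apply: (psumr_eq0P _ b_eq0) => // j _; exact: sqr_ge0.
  by rewrite sqrf_eq0 => /eqP ->; rewrite mulr0.
have : 0 <= \sum_i (b * u i - c * v i) ^+ 2 by exact: sumsq_ge0.
have -> : \sum_i (b * u i - c * v i) ^+ 2 = b * (b * a - c ^+ 2).
  transitivity (\sum_i (b ^+ 2 * u i ^+ 2 + - (2 * b * c) * (u i * v i)
                        + c ^+ 2 * v i ^+ 2)).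
    by apply: eq_bigr => i _; ring.
  by rewrite !big_split/= -!mulr_sumr -/a -/b -/c; ring.
by rewrite pmulr_rge0 ?lt0r ?b_neq0// subr_ge0 mulrC.
Qed.

Lemma minkowski_sum u v :
  Num.sqrt (\sum_i (u i + v i) ^+ 2) <=
  Num.sqrt (\sum_i u i ^+ 2) + Num.sqrt (\sum_i v i ^+ 2).
Proof.
rewrite -(ler_pXn2r (ltn0Sn 1)) ?nnegrE ?addr_ge0 ?sqrtr_ge0//.
rewrite sqr_sqrtr ?sumsq_ge0// sqrrD !sqr_sqrtr ?sumsq_ge0//.
have -> : \sum_i (u i + v i) ^+ 2 =
    \sum_i u i ^+ 2 + (\sum_i u i * v i) *+ 2 + \sum_i v i ^+ 2.
  by rewrite -sumrMnl -!big_split/=; apply: eq_bigr => i _; rewrite sqrrD.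
rewrite lerD2r lerD2l lerMn2r/= -sqrtrM ?sumsq_ge0//.
rewrite (le_trans (ler_norm _))// -sqrtr_sqr ler_wsqrtr//.
exact: cauchy_schwarz_sum.
Qed.

Lemma sumsqD_le u v :
  \sum_i (u i + v i) ^+ 2 <= 2 * (\sum_i u i ^+ 2 + \sum_i v i ^+ 2).
Proof.
rewrite -big_split/= mulr_sumr; apply: ler_sum => i _.
by have := sqr_ge0 (u i - v i); nra.
Qed.

Lemma sqr_sum_le_card u :
  (\sum_i u i) ^+ 2 <= #|I|%:R * \sum_i u i ^+ 2.
Proof.
have := cauchy_schwarz_sum (fun=> 1) u.
under eq_bigr do rewrite mul1r.
by rewrite expr1n sumr_const.
Qed.

(** Here [e] plays the compression error of [a - b]. With [q = sqrt (1 - dl)], two triangle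
    inequalities give [|a - e| <= (1 + q) |a| + q |b|], and the square of the right-hand side is
    dominated by the stated quadratic form in [|a|] and [|b|]. *)
Lemma contraction_bound (dl : R) a b e : 0 < dl <= 1 ->
  \sum_i e i ^+ 2 <= (1 - dl) * \sum_i (a i - b i) ^+ 2 ->
  \sum_i (a i - e i) ^+ 2 <=
    (1 - dl / 4) * \sum_i b i ^+ 2 + (6 / dl - 7 / 2) * \sum_i a i ^+ 2.
Proof.
move=> /andP[dl0 dl1] he.
set q := Num.sqrt (1 - dl).
have q0 : 0 <= q by exact: sqrtr_ge0.
have q2 : q ^+ 2 = 1 - dl by rewrite sqr_sqrtr// subr_ge0.
have q1 : q <= 1 by rewrite -(ler_pXn2r (ltn0Sn 1)) ?nnegrE// q2 expr1n gerBl ltW.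
pose nrm (w : I -> R) := Num.sqrt (\sum_i w i ^+ 2).
have nrm0 w : 0 <= nrm w by exact: sqrtr_ge0.
have nrm2 w : \sum_i w i ^+ 2 = nrm w ^+ 2 by rewrite sqr_sqrtr ?sumsq_ge0.
have nrmB u v : nrm (fun i => u i - v i) <= nrm u + nrm v.
  have -> : nrm v = nrm (fun i => - v i).
    by congr Num.sqrt; apply: eq_bigr => i _; rewrite sqrrN.
  exact: minkowski_sum.
have e_le : nrm e <= q * (nrm a + nrm b).
  apply: le_trans (ler_wpM2l q0 (nrmB a b)).
  by rewrite /q /nrm -sqrtrM ?subr_ge0// ler_wsqrtr.
have ae_le : nrm (fun i => a i - e i) <= (1 + q) * nrm a + q * nrm b.
  by have := nrmB a e; lra.
rewrite !nrm2; set x := nrm a in ae_le *; set y := nrm b in ae_le *.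
have x0 : 0 <= x by exact: nrm0.
have y0 : 0 <= y by exact: nrm0.
apply: (@le_trans _ _ (((1 + q) * x + q * y) ^+ 2)).
  by rewrite ler_pXn2r ?nnegrE ?addr_ge0 ?mulr_ge0 ?addr_ge0.
rewrite -subr_ge0 -(pmulr_rge0 _ dl0).
(* Completing the square in [dl * y] leaves a multiple of [x ^+ 2] whose
   coefficient is a polynomial in [q], positive on [0, 1]. *)
have -> : dl * ((1 - dl / 4) * y ^+ 2 + (6 / dl - 7 / 2) * x ^+ 2
                - ((1 + q) * x + q * y) ^+ 2) =
  3 / 4 * (dl * y - 4 / 3 * (1 + q) * q * x) ^+ 2 +
  (3 / 2 - 2 * q + 13 / 6 * q ^+ 2 - 2 / 3 * q ^+ 3 - 1 / 3 * q ^+ 4) * x ^+ 2.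
  have -> : dl = 1 - q ^+ 2 by rewrite q2; ring.
  have dl_neq0 : 1 - q ^+ 2 != 0 by rewrite q2 subKr gt_eqF.
  by field.
(* Replacing [q ^+ 3] and [q ^+ 4] by the larger [q ^+ 2] leaves [3 / 2 - 2 * q + 7 / 6 * q ^+ 2],
   whose minimum, at [q = 6 / 7], is [9 / 14]. *)
have hq : 0 <= 3 / 2 - 2 * q + 13 / 6 * q ^+ 2 - 2 / 3 * q ^+ 3 - 1 / 3 * q ^+ 4.
  have q3 : q ^+ 3 <= q ^+ 2 by rewrite ler_wiXn2l.
  have q4 : q ^+ 4 <= q ^+ 2 by rewrite ler_wiXn2l.
  have q6 := sqr_ge0 (q - 6 / 7); lra.
by apply: addr_ge0; apply: mulr_ge0; rewrite ?sqr_ge0//; lra.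
Qed.

End SumOfSquares.

Lemma jensen_avg_sumsq (R : realType) (n : nat) (I : finType)
    (u : 'I_n -> I -> R) : (0 < n)%N ->
  \sum_j (n%:R^-1 * \sum_i u i j) ^+ 2 <= n%:R^-1 * \sum_i \sum_j u i j ^+ 2.
Proof.
move=> n0; rewrite exchange_big/= mulr_sumr; apply: ler_sum => j _.
have nR0 : 0 < n%:R :> R by rewrite ltr0n.
rewrite exprMn expr2 -mulrA ler_pM2l ?invr_gt0// ler_pdivrMl//.
by have := sqr_sum_le_card (u^~ j); rewrite card_ord.
Qed.

(** * Norms, positive definite matrices, the projection and basis expansions *)

Section LinearAlgebra.
Variables (R : realType) (d : nat).
Implicit Types (u v w : 'cV[R]_d) (A S P : 'M[R]_d).

Lemma entryB m k (X Y : 'M[R]_(m, k)) i j : (X - Y) i j = X i j - Y i j.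
Proof. by rewrite !mxE. Qed.

Lemma dot_mxE u v : (u^T *m v) 0 0 = \sum_j u j 0 * v j 0.
Proof. by rewrite mxE; apply: eq_bigr => j _; rewrite mxE. Qed.

(** Indexing by pairs turns a matrix into a family over a finite type, to which the sum-of-squares
    lemmas apply. *)
Lemma frob2E A : frob2 A = \sum_(p : 'I_d * 'I_d) A p.1 p.2 ^+ 2.
Proof. by rewrite /frob2 pair_bigA. Qed.

Lemma sqnorm_ge0 v : 0 <= sqnorm v.
Proof. exact: sumsq_ge0. Qed.

Lemma frob2_ge0 A : 0 <= frob2 A.
Proof. by rewrite frob2E sumsq_ge0. Qed.

Lemma frob2_le_of_sqrt A (c : R) : Num.sqrt (frob2 A) <= c -> frob2 A <= c ^+ 2.
Proof.
move=> h; have s0 := sqrtr_ge0 (frob2 A).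
by rewrite -(sqr_sqrtr (frob2_ge0 A)) ler_pXn2r ?nnegrE// (le_trans s0).
Qed.

Lemma sqr_vnorm v : vnorm v ^+ 2 = sqnorm v.
Proof. by rewrite sqr_sqrtr ?sqnorm_ge0. Qed.

Lemma vnorm_ge0 v : 0 <= vnorm v.
Proof. exact: sqrtr_ge0. Qed.

Lemma sqnormD_le u v : sqnorm (u + v) <= 2 * (sqnorm u + sqnorm v).
Proof.
rewrite /sqnorm (le_trans _ (sumsqD_le _ _))//.
by under eq_bigr do rewrite mxE.
Qed.

Lemma sqnormN v : sqnorm (- v) = sqnorm v.
Proof. by apply: eq_bigr => j _; rewrite mxE sqrrN. Qed.

Lemma sqnormZ (k : R) v : sqnorm (k *: v) = k ^+ 2 * sqnorm v.
Proof. by rewrite /sqnorm mulr_sumr; apply: eq_bigr => j _; rewrite mxE exprMn. Qed.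

Lemma sqnorm_eq0 v : sqnorm v <= 0 -> v = 0.
Proof.
move=> v0; have v_eq0 : sqnorm v = 0 by apply/eqP; rewrite eq_le v0 sqnorm_ge0.
apply/matrixP => j k; rewrite ord1 mxE; apply/eqP; rewrite -sqrf_eq0; apply/eqP.
by apply: (psumr_eq0P _ v_eq0) => // i _; exact: sqr_ge0.
Qed.

Lemma sqr_dot_le u v : (u^T *m v) 0 0 ^+ 2 <= sqnorm u * sqnorm v.
Proof. by rewrite dot_mxE; exact: cauchy_schwarz_sum. Qed.

Lemma sqnorm_mulmx_le A v : sqnorm (A *m v) <= frob2 A * sqnorm v.
Proof.
rewrite /sqnorm /frob2 mulr_suml; apply: ler_sum => j _.
by rewrite mxE; exact: cauchy_schwarz_sum.
Qed.

(** A row [r] of the kernel of [P^T] satisfies [P *m r^T = 0], so [mu * sqnorm r^T <= 0] and [r]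
    vanishes. *)
Lemma psd_ge_unitmx P (mu : R) : 0 < mu -> psd_ge P mu -> P \in unitmx.
Proof.
move=> mu0 hP; rewrite -unitmx_tr -row_free_unit -kermx_eq0.
apply/eqP/row_matrixP => i; rewrite row0.
set r := row i _; have : r *m P^T = 0.
  by rewrite /r -row_mul mulmx_ker row0.
move=> /(congr1 trmx); rewrite trmx_mul trmxK trmx0 => Pr.
rewrite -[r]trmxK (@sqnorm_eq0 r^T) ?trmx0//.
have := hP r^T; rewrite -mulmxA Pr mulmx0 [X in _ <= X]mxE.
by rewrite pmulr_rle0.
Qed.

(** For [y = invmx P *m v], positivity and Cauchy-Schwarz give [mu |y|^2 <= <y, v> <= |y| |v|];
    divide by [|y|] after squaring. *)
Lemma sqnorm_invmx_le P (mu : R) v : 0 < mu -> psd_ge P mu ->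
  mu ^+ 2 * sqnorm (invmx P *m v) <= sqnorm v.
Proof.
move=> mu0 hP; set y := invmx P *m v.
have Py : P *m y = v by rewrite mulKVmx// (psd_ge_unitmx mu0).
have [y0|y_neq0] := eqVneq (sqnorm y) 0; first by rewrite y0 mulr0 sqnorm_ge0.
have y_gt0 : 0 < sqnorm y by rewrite lt0r y_neq0 sqnorm_ge0.
have := hP y; rewrite -mulmxA Py => h1; have h2 := sqr_dot_le y v.
rewrite -(ler_pM2l y_gt0); apply: le_trans h2.
have -> : sqnorm y * (mu ^+ 2 * sqnorm y) = (mu * sqnorm y) ^+ 2 by ring.
have m0 : 0 <= mu * sqnorm y by rewrite mulr_ge0 ?ltW.
by rewrite ler_pXn2r ?nnegrE// (le_trans m0).
Qed.

Lemma frob2D A S : frob2 (A + S) = frob2 A + 2 * frobdot A S + frob2 S.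
Proof.
rewrite /frob2 /frobdot mulr_sumr -!big_split/=; apply: eq_bigr => a _.
rewrite mulr_sumr -!big_split/=; apply: eq_bigr => b _.
by rewrite mxE; ring.
Qed.

Lemma frob2Z (k : R) A : frob2 (k *: A) = k ^+ 2 * frob2 A.
Proof.
rewrite /frob2 mulr_sumr; apply: eq_bigr => a _; rewrite mulr_sumr.
by apply: eq_bigr => b _; rewrite mxE exprMn.
Qed.

Lemma frobdotZr (k : R) A S : frobdot A (k *: S) = k * frobdot A S.
Proof.
rewrite /frobdot mulr_sumr; apply: eq_bigr => a _; rewrite mulr_sumr.
by apply: eq_bigr => b _; rewrite mxE; ring.
Qed.

Lemma psd_ge_convex (mu t : R) P S : 0 <= t <= 1 -> psd_ge P mu -> psd_ge S mu ->
  psd_ge ((1 - t) *: P + t *: S) mu.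
Proof.
move=> /andP[t0 t1] hP hS v; rewrite mulmxDr mulmxDl mxE -!scalemxAr -!scalemxAl.
by rewrite [X in _ <= X + _]mxE [X in _ <= _ + X]mxE;
  have := hP v; have := hS v; nra.
Qed.

(** Moving from [P] towards [S] stays in the convex set, so minimality of [P] gives
    [2 <E, D> + t |D|^2 >= 0] for all [t] in [(0, 1]], hence [<E, D> >= 0]. Expanding [|E + D|^2],
    with [E + D = A - S], concludes. *)
Lemma proj_mu_nonexpansive (mu : R) A P S : is_proj_mu mu A P ->
  Defs.symmetric S -> psd_ge S mu -> frob2 (P - S) <= frob2 (A - S).
Proof.
move=> [symP [psdP minP]] symS psdS.
set E := A - P; set D := P - S.
have key t : 0 < t <= 1 -> 0 <= 2 * frobdot E D + t * frob2 D.
  move=> /andP[t0 t1].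
  have symQ : Defs.symmetric ((1 - t) *: P + t *: S).
    by rewrite /Defs.symmetric linearD !linearZ/= symP symS.
  have psdQ : psd_ge ((1 - t) *: P + t *: S) mu.
    by apply: psd_ge_convex => //; rewrite t1 ltW.
  have := minP _ symQ psdQ.
  have -> : A - ((1 - t) *: P + t *: S) = E + t *: D.
    by rewrite /E /D scalerBl scalerBr scale1r; apply/matrixP => i j; rewrite !mxE; ring.
  rewrite -/E frob2D frob2Z frobdotZr -addrA lerDl => h.
  by rewrite -(pmulr_rge0 _ t0); nra.
have ED : 0 <= frobdot E D.
  rewrite leNgt; apply/negP => ED.
  have D0 := frob2_ge0 D.
  (* If [<E, D> < 0], this [t] makes [t |D|^2 < - <E, D>], which contradicts [key]; the [+ 1] keeps
     the denominator positive. *)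
  pose t := Num.min 1 (- frobdot E D / (frob2 D + 1)).
  have D1 : 0 < frob2 D + 1 by lra.
  have t0 : 0 < t by rewrite lt_min ltr01 divr_gt0// oppr_gt0.
  have tle : t * (frob2 D + 1) <= - frobdot E D.
    by rewrite -ler_pdivlMr// ge_min lexx orbT.
  have := key t; rewrite t0 ge_min lexx => /(_ isT); nra.
have -> : A - S = E + D by rewrite /E /D subrKA.
by rewrite frob2D lerDr; have := frob2_ge0 E; lra.
Qed.

(** The Newton error is [P^-1 ((P - S) v - (r - S v))]. The factor 2 is the price of splitting the
    squared norm of this sum. *)
Lemma newton_step_bound (mu E K : R) P S v (r : 'cV[R]_d) : 0 < mu ->
  psd_ge P mu -> frob2 (P - S) <= E ->
  sqnorm (r - S *m v) <= K ^+ 2 * sqnorm v ^+ 2 ->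
  mu ^+ 2 * sqnorm (v - invmx P *m r) <=
    2 * sqnorm v * (E + K ^+ 2 * sqnorm v).
Proof.
move=> mu0 hP hE hr.
have -> : v - invmx P *m r = invmx P *m ((P - S) *m v + - (r - S *m v)).
  have uP := psd_ge_unitmx mu0 hP.
  by rewrite mulmxBl opprB subrKA mulmxBr mulKmx.
apply: le_trans (sqnorm_invmx_le _ mu0 hP) _.
apply: le_trans (sqnormD_le _ _) _; rewrite sqnormN.
have := sqnorm_mulmx_le (P - S) v.
have := ler_wpM2r (sqnorm_ge0 v) hE.
by lra.
Qed.

Lemma sqnorm_contraction (dl : R) u v w : 0 < dl <= 1 ->
  sqnorm w <= (1 - dl) * sqnorm (u - v) ->
  sqnorm (u - w) <= (1 - dl / 4) * sqnorm v + (6 / dl - 7 / 2) * sqnorm u.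
Proof.
move=> hdl hw.
have sB (x y : 'cV[R]_d) : sqnorm (x - y) = \sum_j (x j 0 - y j 0) ^+ 2.
  by apply: eq_bigr => j _; rewrite !mxE.
by rewrite sB; apply: contraction_bound => //; rewrite -sB.
Qed.

Lemma frob2_contraction (dl : R) A S P : 0 < dl <= 1 ->
  frob2 P <= (1 - dl) * frob2 (A - S) ->
  frob2 (A - P) <= (1 - dl / 4) * frob2 S + (6 / dl - 7 / 2) * frob2 A.
Proof.
move=> hdl hw.
have sB (X Y : 'M[R]_d) : frob2 (X - Y) =
    \sum_(p : 'I_d * 'I_d) (X p.1 p.2 - Y p.1 p.2) ^+ 2.
  by rewrite frob2E; apply: eq_bigr => j _; rewrite !mxE.
rewrite sB (frob2E A) (frob2E S); apply: contraction_bound => //.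
by rewrite -sB -frob2E.
Qed.

Lemma sqnorm_avg_le n (u : 'I_n -> 'cV[R]_d) : (0 < n)%N ->
  sqnorm (n%:R^-1 *: \sum_i u i) <= n%:R^-1 * \sum_i sqnorm (u i).
Proof.
move=> n0; rewrite (le_trans _ (jensen_avg_sumsq _ n0))//.
by rewrite /sqnorm; under eq_bigr do rewrite mxE summxE.
Qed.

Lemma frob2_avg_le n (A : 'I_n -> 'M[R]_d) : (0 < n)%N ->
  frob2 (n%:R^-1 *: \sum_i A i) <= n%:R^-1 * \sum_i frob2 (A i).
Proof.
move=> n0; rewrite frob2E; under [in leRHS]eq_bigr do rewrite frob2E.
apply: le_trans (jensen_avg_sumsq _ n0).
by under eq_bigr do rewrite mxE summxE.
Qed.

(** Cauchy-Schwarz over the [d ^ 2] terms of the expansion; this is the value of [NB] for general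
    bases. *)
Lemma frob2_sum_le (B : 'I_d -> 'I_d -> 'M[R]_d) (c : 'M[R]_d) (r : R) :
  (forall j l, frob2 (B j l) <= r) ->
  frob2 (\sum_j \sum_l c j l *: B j l) <= (d ^ 2)%:R * (r * frob2 c).
Proof.
move=> hB; rewrite pair_bigA/= frob2E.
apply: (@le_trans _ _ (\sum_(q : 'I_d * 'I_d) (d ^ 2)%:R *
    \sum_(p : 'I_d * 'I_d) (c p.1 p.2 * B p.1 p.2 q.1 q.2) ^+ 2)).
  apply: ler_sum => q _; rewrite summxE.
  under eq_bigr do rewrite mxE.
  apply: le_trans (sqr_sum_le_card _) _.
  by rewrite card_prod card_ord mulnn.
rewrite -mulr_sumr ler_wpM2l ?ler0n// exchange_big/= (frob2E c) mulr_sumr.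
apply: ler_sum => p _; under eq_bigr do rewrite exprMn.
by rewrite -mulr_sumr -frob2E mulrC ler_wpM2r ?sqr_ge0.
Qed.

(** In the double sum of inner products of the terms, orthogonality kills everything off the
    diagonal, so no dimension factor appears. *)
Lemma frob2_sum_orthogonal (B : 'I_d -> 'I_d -> 'M[R]_d) (c : 'M[R]_d) (r : R) :
  frob_orthogonal_basis B -> (forall j l, frob2 (B j l) <= r) ->
  frob2 (\sum_j \sum_l c j l *: B j l) <= r * frob2 c.
Proof.
move=> oB hB; rewrite pair_bigA/=.
have frobdotE X Y : frobdot X Y = \sum_(q : 'I_d * 'I_d) X q.1 q.2 * Y q.1 q.2.
  by rewrite /frobdot pair_bigA.
rewrite (_ : frob2 _ = \sum_(p : 'I_d * 'I_d) \sum_(p' : 'I_d * 'I_d)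
    c p.1 p.2 * c p'.1 p'.2 * frobdot (B p.1 p.2) (B p'.1 p'.2)); last first.
  rewrite frob2E; under [LHS]eq_bigr do rewrite summxE expr2 mulr_suml.
  rewrite exchange_big/=; apply: eq_bigr => p _.
  under eq_bigr do rewrite mulr_sumr.
  rewrite exchange_big/=; apply: eq_bigr => p' _.
  rewrite frobdotE mulr_sumr; apply: eq_bigr => q _.
  by rewrite !mxE; ring.
rewrite (frob2E c) mulr_sumr; apply: ler_sum => p _.
rewrite (bigD1 p)//= big1 ?addr0 => [|p' p'p]; last first.
  by rewrite oB ?mulr0// -!surjective_pairing eq_sym.
rewrite -expr2 mulrC ler_wpM2r ?sqr_ge0//.
by rewrite (_ : frobdot _ _ = frob2 (B p.1 p.2)).
Qed.

End LinearAlgebra.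

(** * From coefficient errors to errors of the Hessian estimate *)

Lemma NB_gt0 (R : realType) (d n : nat) (B : 'I_n -> 'I_d -> 'I_d -> 'M[R]_d) :
  (0 < d)%N -> 0 < NB B.
Proof. by move=> d0; rewrite /NB; case: ifP => // _; rewrite ltr0n expn_gt0 d0. Qed.

Lemma frob2_HmatB_le (R : realType) (d n : nat)
    (B : 'I_n -> 'I_d -> 'I_d -> 'M[R]_d) (L L' : 'I_n -> 'M[R]_d) (Rb : R) :
  (0 < n)%N -> (forall i j l, Num.sqrt (frob2 (B i j l)) <= Rb) ->
  frob2 (Hmat B L - Hmat B L') <= NB B * Rb ^+ 2 * Hcal L L'.
Proof.
move=> n0 hB.
have hB2 i j l : frob2 (B i j l) <= Rb ^+ 2 by exact: frob2_le_of_sqrt.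
have -> : Hmat B L - Hmat B L' =
    n%:R^-1 *: \sum_i \sum_j \sum_l (L i - L' i) j l *: B i j l.
  rewrite /Hmat -scalerBr -sumrB; congr (_ *: _); apply: eq_bigr => i _.
  rewrite -sumrB; apply: eq_bigr => j _; rewrite -sumrB; apply: eq_bigr => l _.
  by rewrite !mxE scalerBl.
apply: le_trans (frob2_avg_le _ n0) _.
rewrite /Hcal mulrCA ler_wpM2l ?invr_ge0 ?ler0n// mulr_sumr.
apply: ler_sum => i _; rewrite -mulrA /NB; case: ifPn => [/asboolP oB|_].
  by rewrite mul1r; apply: frob2_sum_orthogonal => //; exact: oB.
exact: frob2_sum_le.
Qed.

(** * Symmetry and lower bound of the Hessian, Taylor remainder of the gradient *)

Section Calculus.
Variables (R : realType) (d : nat).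
Implicit Types (u v w x : 'cV[R]_d).

(** Both derivatives are limits of the same difference quotient. This reduces directional
    derivatives to one real variable, where the mean value theorem lives. *)
Lemma is_derive_line (V W : normedModType R) (f : V -> W) (x v : V) (t : R) (df : W) :
  is_derive (x + t *: v) v f df -> is_derive t 1 (fun s : R => f (x + s *: v)) df.
Proof.
move=> [df_ex df_val].
have E : (fun h : R => h^-1 *:
      (((fun s : R => f (x + s *: v)) \o shift t) (h *: 1) - f (x + t *: v))) =
    (fun h : R => h^-1 *: ((f \o shift (x + t *: v)) (h *: v) - f (x + t *: v))).
  apply/funext => h /=; congr (_ *: (f _ - _)).
  by rewrite [h *: 1]mulr1 scalerDl addrCA.
by split; [rewrite /derivable E|rewrite /derive E].
Qed.

Lemma is_derive_dot (V : normedModType R) (G : V -> 'cV[R]_d) (y z : V) u dG :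
  is_derive y z G dG ->
  is_derive y z (fun p => (u^T *m G p) 0 0) ((u^T *m dG) 0 0).
Proof.
move=> [G_ex G_val].
have G_entry j : is_derive y z (fun p => G p j 0) (dG j 0).
  split; first by move/derivable_mxP : G_ex; apply.
  by rewrite -G_val derive_mx// mxE.
rewrite dot_mxE.
rewrite (_ : (fun p => _) = \sum_j (u j 0 \*: (fun p => G p j 0))); last first.
  by apply/funext => p; rewrite dot_mxE fct_sumE.
by apply: is_derive_sum => j; exact: is_deriveZ.
Qed.

Lemma MVT_everywhere (F dF : R -> R) (a b : R) : a < b ->
  (forall t : R, is_derive t 1 F (dF t)) ->
  exists2 c, a < c < b & F b - F a = dF c * (b - a).
Proof.
move=> ab hF.
have cF : {within `[a, b], continuous F}.
  by apply: derivable_within_continuous => t _; have [] := hF t.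
have [c + E] := MVT ab (fun t _ => hF t) cF.
by rewrite in_itv/= => hc; exists c.
Qed.

(** Serves as the passage to the limit [s -> 0] in the Hessian arguments; the witness is
    [s = y / (|C| + 1)]. *)
Lemma le0_of_le_small (y C : R) : (forall s, 0 < s -> y <= C * s) -> y <= 0.
Proof.
move=> h; rewrite leNgt; apply/negP => y0.
have C1 : 0 < `|C| + 1 by have := normr_ge0 C; lra.
have := h (y / (`|C| + 1)) (divr_gt0 y0 C1).
rewrite mulrA ler_pdivlMr//; have := ler_norm C; nra.
Qed.

Variables (f : 'cV[R]_d -> R) (G : 'cV[R]_d -> 'cV[R]_d) (Hs : 'cV[R]_d -> 'M[R]_d).
Hypotheses (hG : has_grad f G) (hH : has_hess G Hs).
Variable K : R.
Hypothesis hK : forall x y, opnorm_le (Hs x - Hs y) (K * vnorm (x - y)).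

(** The mean value theorem is applied twice: to [a |-> f (x + s v + a u) - f (x + a u)], then to
    [b |-> <u, G (x + a u + b v)>]. The second difference on the left is symmetric in [u] and [v],
    which is what forces the Hessian to be symmetric. *)
Lemma mixed_difference x u v (s : R) : 0 < s -> exists a b : R,
  [/\ 0 < a < s, 0 < b < s &
  f (x + s *: v + s *: u) - f (x + s *: u) - (f (x + s *: v) - f x) =
    (u^T *m Hs (x + a *: u + b *: v) *m v) 0 0 * s ^+ 2].
Proof.
move=> s0.
have dF (t : R) : is_derive t 1 (fun a : R => f (x + s *: v + a *: u) - f (x + a *: u))
    ((u^T *m (G (x + t *: u + s *: v) - G (x + t *: u))) 0 0).
  have -> : (u^T *m (G (x + t *: u + s *: v) - G (x + t *: u))) 0 0 =
      ((G (x + s *: v + t *: u))^T *m u) 0 0 - ((G (x + t *: u))^T *m u) 0 0.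
    rewrite !dot_mxE -sumrB; apply: eq_bigr => j _.
    by rewrite !mxE (addrAC x) mulrBr ![u j 0 * _]mulrC.
  apply: is_deriveB; apply: is_derive_line; exact: hG.
have [a ha] := MVT_everywhere s0 dF.
rewrite !scale0r !addr0 subr0 => Ea.
have dP (t : R) : is_derive t 1 (fun b : R => (u^T *m G (x + a *: u + b *: v)) 0 0)
    ((u^T *m (Hs (x + a *: u + t *: v) *m v)) 0 0).
  exact: (is_derive_line (is_derive_dot _ (hH _ _))).
have [b hb] := MVT_everywhere s0 dP.
rewrite scale0r addr0 subr0 => Eb.
exists a, b; split => //; rewrite Ea mulmxBr entryB Eb.
by rewrite mulmxA; ring.
Qed.

Lemma hess_form_lipschitz x y u v :
  ((u^T *m Hs y *m v) 0 0 - (u^T *m Hs x *m v) 0 0) ^+ 2 <=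
  K ^+ 2 * sqnorm (y - x) * (sqnorm u * sqnorm v).
Proof.
have -> : (u^T *m Hs y *m v) 0 0 - (u^T *m Hs x *m v) 0 0 =
    (u^T *m ((Hs y - Hs x) *m v)) 0 0.
  by rewrite mulmxBl mulmxBr !mulmxA entryB.
apply: le_trans (sqr_dot_le _ _) _; rewrite mulrCA.
rewrite ler_wpM2l ?sqnorm_ge0//; have [_ /(_ v)] := hK y x.
by rewrite exprMn sqr_vnorm.
Qed.

(** The displacement satisfies [|a u + b v|^2 <= 2 s^2 (|u|^2 + |v|^2)], so the Lipschitz bound is
    at most [D * s ^+ 2]. Signed [a] and [b] are allowed because [hess_psd] uses the displacement
    [a - s]. *)
Lemma hess_form_near x u v : exists C : R, forall s a b : R, 0 < s ->
  `|a| <= s -> `|b| <= s ->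
  `|(u^T *m Hs (x + a *: u + b *: v) *m v) 0 0 - (u^T *m Hs x *m v) 0 0| <= C * s.
Proof.
pose D := K ^+ 2 * (2 * (sqnorm u + sqnorm v)) * (sqnorm u * sqnorm v).
have u0 := sqnorm_ge0 u; have v0 := sqnorm_ge0 v.
have D0 : 0 <= D by do ?[exact: sqr_ge0|apply: addr_ge0 => //|apply: mulr_ge0 => //].
exists (Num.sqrt D) => s a b s0 ha hb.
rewrite -(ler_pXn2r (ltn0Sn 1)) ?nnegrE ?mulr_ge0 ?sqrtr_ge0 ?(ltW s0)//.
rewrite exprMn sqr_sqrtr// real_normK ?num_real//.
apply: le_trans (hess_form_lipschitz _ _ _ _) _.
have -> : D * s ^+ 2 = K ^+ 2 * (2 * (s ^+ 2 * sqnorm u + s ^+ 2 * sqnorm v)) *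
    (sqnorm u * sqnorm v) by rewrite /D; ring.
rewrite ler_wpM2r ?mulr_ge0// ler_wpM2l ?sqr_ge0//.
rewrite -[x + _ + _]addrA [_ - x]addrC addKr.
apply: le_trans (sqnormD_le _ _) _; rewrite !sqnormZ ler_wpM2l//.
have sq c : `|c| <= s -> c ^+ 2 <= s ^+ 2.
  by move=> cs; rewrite -[c ^+ 2]real_normK ?num_real// ler_pXn2r ?nnegrE ?(ltW s0).
by rewrite lerD// ler_wpM2r// sq.
Qed.

(** Exchanging [u] and [v] preserves the second difference, so the two forms agree at points within
    [O(s)] of [x]; then [s] tends to 0. Equality follows by applying this to both orders. *)
Lemma hess_form_sym_le x u v :
  (u^T *m Hs x *m v) 0 0 <= (v^T *m Hs x *m u) 0 0.
Proof.
have [C hC] := hess_form_near x u v; have [C' hC'] := hess_form_near x v u.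
rewrite -subr_le0; apply: (@le0_of_le_small _ (C + C')) => s s0.
have [a [b [/andP[a0 a1] /andP[b0 b1] E]]] := mixed_difference x u v s0.
have [a' [b' [/andP[a0' a1'] /andP[b0' b1'] E']]] := mixed_difference x v u s0.
have := hC s a b s0; rewrite (gtr0_norm a0) (gtr0_norm b0).
move=> /(_ (ltW a1) (ltW b1)) /ler_normlP[h1 _].
have := hC' s a' b' s0; rewrite (gtr0_norm a0') (gtr0_norm b0').
move=> /(_ (ltW a1') (ltW b1')) /ler_normlP[_ h2].
suff : (u^T *m Hs (x + a *: u + b *: v) *m v) 0 0 =
       (v^T *m Hs (x + a' *: v + b' *: u) *m u) 0 0 by lra.
have s2 : s ^+ 2 != 0 by rewrite sqrf_eq0 gt_eqF.
by apply: (mulIf s2); rewrite -E -E' [x + _ + s *: u]addrAC; ring.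
Qed.

Lemma hess_symmetric x : Defs.symmetric (Hs x).
Proof.
have form u v : (u^T *m Hs x *m v) 0 0 = (v^T *m Hs x *m u) 0 0.
  by apply/eqP; rewrite eq_le !hess_form_sym_le.
apply/matrixP => i j; rewrite mxE.
have := form (delta_mx j 0) (delta_mx i 0).
by rewrite !trmx_delta -!rowE -!colE !mxE.
Qed.

(* Strong convexity at the midpoint of [x - s v] and [x + s v] bounds from below
   the second difference, which is [s ^+ 2] times a Hessian form near [x]. *)
Lemma hess_psd (mu : R) x : strongly_convex mu f -> psd_ge (Hs x) mu.
Proof.
move=> hf v; have [C hC] := hess_form_near x v v.
rewrite -subr_le0; apply: (@le0_of_le_small _ C) => s s0.
have [a [b [/andP[a0 a1] /andP[b0 b1] E]]] := mixed_difference (x - s *: v) v v s0.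
have ha : `|a - s| <= s by rewrite ler_norml; lra.
have hb : `|b| <= s by rewrite gtr0_norm// ltW.
have := hC s (a - s) b s0 ha hb => /ler_normlP[_].
have -> : x + (a - s) *: v + b *: v = x - s *: v + a *: v + b *: v.
  by rewrite scalerBl addrA (addrAC x).
have half01 : 0 <= (2^-1 : R) <= 1 by lra.
have := hf (x + s *: v) (x - s *: v) 2^-1 half01.
rewrite (_ : 2^-1 *: (x + s *: v) + (1 - 2^-1) *: (x - s *: v) = x); last first.
  by apply/matrixP => i j; rewrite !mxE; field.
rewrite (_ : x + s *: v - (x - s *: v) = (2 * s) *: v); last first.
  by apply/matrixP => i j; rewrite !mxE; ring.
rewrite sqnormZ => h1.
move: E; rewrite subrK => E h2.
suff : mu * sqnorm v <= (v^T *m Hs (x - s *: v + a *: v + b *: v) *m v) 0 0 by lra.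
have s2 : 0 < s ^+ 2 by rewrite exprn_gt0.
rewrite -(ler_pM2r s2) -E.
(* The right-hand side is twice the convexity gap at the midpoint, written as it appears in [h1] so
   that linear arithmetic recognizes it. *)
have -> : mu * sqnorm v * s ^+ 2 = mu / 2 / 2 * (1 - 2^-1) * ((2 * s) ^+ 2 * sqnorm v) * 2.
  by field.
lra.
Qed.

(** The mean value theorem is applied to [G] along the segment, tested against the remainder [r]
    itself: [|r|^2 = <r, (Hs (x + c v) - Hs x) v> <= |r| K c |v|^2] with [c < 1]. *)
Lemma grad_taylor x w :
  sqnorm (G w - G x - Hs x *m (w - x)) <= K ^+ 2 * sqnorm (w - x) ^+ 2.
Proof.
set v := w - x; set r := _ - _.
have [->|r_neq0] := eqVneq (sqnorm r) 0; first by rewrite mulr_ge0 ?sqr_ge0.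
have r0 : 0 < sqnorm r by rewrite lt0r r_neq0 sqnorm_ge0.
have dP (t : R) : is_derive t 1 (fun b : R => (r^T *m G (x + b *: v)) 0 0)
    ((r^T *m (Hs (x + t *: v) *m v)) 0 0).
  exact: (is_derive_line (is_derive_dot _ (hH _ _))).
have [c /andP[c0 c1]] := MVT_everywhere ltr01 dP.
rewrite scale0r addr0 scale1r subr0 mulr1 /v subrKC -/v => E.
have rr : sqnorm r = (r^T *m Hs (x + c *: v) *m v) 0 0 - (r^T *m Hs x *m v) 0 0.
  rewrite -!mulmxA -E (_ : sqnorm r = (r^T *m r) 0 0); last first.
    by rewrite dot_mxE; apply: eq_bigr => j _; rewrite expr2.
  by rewrite {2}/r !mulmxBr !entryB.
have := hess_form_lipschitz x (x + c *: v) r v; rewrite -rr.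
rewrite [x + _ - x]addrC addKr sqnormZ => h.
rewrite -(ler_pM2l r0) -expr2; apply: le_trans h _.
have -> : K ^+ 2 * (c ^+ 2 * sqnorm v) * (sqnorm r * sqnorm v) =
  c ^+ 2 * (sqnorm r * (K ^+ 2 * sqnorm v ^+ 2)) by ring.
apply: ler_piMl; last by rewrite exprn_ile1 ?(ltW c0) ?(ltW c1).
by rewrite mulr_ge0 ?sqnorm_ge0// mulr_ge0 ?sqr_ge0.
Qed.

(** The function [s |-> f (x + s G x)] has a minimum at 0, and its derivative there is [|G x|^2]. *)
Lemma grad_at_min x : (forall y, f x <= f y) -> G x = 0.
Proof.
move=> hx; apply: sqnorm_eq0.
have dF (t : R) : is_derive t 1 (fun s : R => f (x + s *: G x))
    (((G (x + t *: G x))^T *m G x) 0 0).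
  exact: (is_derive_line (hG _ _)).
have m0 : is_derive (0 : R) 1 (fun s : R => f (x + s *: G x)) 0.
  have i0 : (0 : R) \in `]-1, 1[ by rewrite in_itv/= ltrN10 ltr01.
  apply: (derive1_at_min _ _ i0) => [|t _|t _].
  - by rewrite (le_trans (lerN10 _)) ?ler01.
  - by have [] := dF t.
  - by rewrite scale0r addr0.
have [_] := dF 0; have [_ ->] := m0.
rewrite scale0r addr0 dot_mxE => ->.
by apply: ler_sum => j _; rewrite expr2.
Qed.

End Calculus.

(** * The averaged function inherits gradient, Hessian and Lipschitz constant *)

Section Average.
Variables (R : realType) (d n : nat).
Variables (fi : 'I_n -> 'cV[R]_d -> R) (g : 'I_n -> 'cV[R]_d -> 'cV[R]_d).
Variable hs : 'I_n -> 'cV[R]_d -> 'M[R]_d.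

Definition havg (x : 'cV[R]_d) : 'M[R]_d := n%:R^-1 *: \sum_i hs i x.

Lemma has_grad_avg : (forall i, has_grad (fi i) (g i)) -> has_grad (favg fi) (gavg g).
Proof.
move=> hg x v.
have -> : ((gavg g x)^T *m v) 0 0 = n%:R^-1 *: \sum_i ((g i x)^T *m v) 0 0.
  by rewrite /gavg linearZ/= -scalemxAl mxE linear_sum/= mulmx_suml summxE.
rewrite (_ : favg fi = n%:R^-1 \*: (\sum_i fi i)); last first.
  by apply/funext => y; rewrite /favg/= fct_sumE.
by apply: is_deriveZ; apply: is_derive_sum => i; exact: hg.
Qed.

Lemma has_hess_avg : (forall i, has_hess (g i) (hs i)) -> has_hess (gavg g) havg.
Proof.
move=> hg x v.
have -> : havg x *m v = n%:R^-1 *: \sum_i (hs i x *m v).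
  by rewrite /havg -scalemxAl mulmx_suml.
rewrite (_ : gavg g = n%:R^-1 \*: (\sum_i g i)); last first.
  by apply/funext => y; rewrite /gavg/= fct_sumE.
by apply: is_deriveZ; apply: is_derive_sum => i; exact: hg.
Qed.

Lemma havg_lipschitz (K : R) : (0 < n)%N ->
  (forall i x y, opnorm_le (hs i x - hs i y) (K * vnorm (x - y))) ->
  forall x y, opnorm_le (havg x - havg y) (K * vnorm (x - y)).
Proof.
move=> n0 hK x y; split; first by have [] := hK (Ordinal n0) x y.
move=> v.
have -> : (havg x - havg y) *m v = n%:R^-1 *: \sum_i ((hs i x - hs i y) *m v).
  by rewrite /havg -scalerBr -sumrB -scalemxAl mulmx_suml.
apply: le_trans (sqnorm_avg_le _ n0) _.
rewrite ler_pdivrMl ?ltr0n//.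
apply: (@le_trans _ _ (\sum_(i < n) (K * vnorm (x - y)) ^+ 2 * sqnorm v)).
  by apply: ler_sum => i _; have [_] := hK i x y; apply.
by rewrite sumr_const card_ord mulr_natl.
Qed.

End Average.

Lemma convex_comb_sqr_le (R : realType) (k : nat) (lam x : nat -> R) (y c b : R) :
  (forall t, 0 <= lam t) -> \sum_(t < k.+1) lam t = 1 ->
  y = \sum_(t < k.+1) lam t * x t ->
  (forall t, (t <= k)%N -> (x t - c) ^+ 2 <= b) -> (y - c) ^+ 2 <= b.
Proof.
move=> lam0 lam1 yE hx.
have E : \sum_(t < k.+1) lam t * (x t - c) ^+ 2 =
    (y - c) ^+ 2 + \sum_(t < k.+1) lam t * (x t - y) ^+ 2.
  transitivity (\sum_(t < k.+1) (lam t * (x t - y) ^+ 2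
      + 2 * (y - c) * (lam t * x t) + (c ^+ 2 - y ^+ 2) * lam t)).
    by apply: eq_bigr => t _; ring.
  by rewrite !big_split/= -!mulr_sumr -yE lam1; ring.
apply: (@le_trans _ _ (\sum_(t < k.+1) lam t * (x t - c) ^+ 2)).
  rewrite E lerDl; apply: sumr_ge0 => t _.
  by apply: mulr_ge0; [exact: lam0|exact: sqr_ge0].
rewrite -[b]mul1r -lam1 mulr_suml; apply: ler_sum => t _.
by apply: ler_wpM2l; [exact: lam0|apply: hx; rewrite -ltnS].
Qed.

Definition convex_comb_of (R : realType) (k : nat) (x : nat -> R) (y : R) : Prop :=
  exists lam : nat -> R,
    (forall t, 0 <= lam t) /\ \sum_(t < k.+1) lam t = 1 /\
    y = \sum_(t < k.+1) lam t * x t.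

Lemma sqnorm_convex_comb (R : realType) (d k : nat) (x : nat -> 'cV[R]_d)
    (z c : 'cV[R]_d) (b : R) :
  (forall j, convex_comb_of k (fun t => x t j 0) (z j 0)) ->
  (forall t, (t <= k)%N -> sqnorm (x t - c) <= b) ->
  sqnorm (z - c) <= d%:R * b.
Proof.
move=> hz hx; rewrite -[X in X%:R * _](card_ord d) mulr_natl -sumr_const.
apply: ler_sum => j _; rewrite entryB.
have [lam [lam0 [lam1 E]]] := hz j.
apply: (convex_comb_sqr_le (x := fun t => x t j 0) lam0 lam1 E) => t tk; apply: le_trans (hx t tk).
rewrite /= -entryB /sqnorm [leRHS](bigD1 j)//= lerDl.
by apply: sumr_ge0 => i _; exact: sqr_ge0.
Qed.

Lemma frob2_convex_comb (R : realType) (d k : nat) (A : nat -> 'M[R]_d)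
    (L C : 'M[R]_d) (b : R) :
  (forall j l, convex_comb_of k (fun t => A t j l) (L j l)) ->
  (forall t j l, (t <= k)%N -> (A t j l - C j l) ^+ 2 <= b) ->
  frob2 (L - C) <= d%:R ^+ 2 * b.
Proof.
move=> hL hA.
have -> : d%:R ^+ 2 * b = \sum_(p : 'I_d * 'I_d) b.
  by rewrite sumr_const card_prod card_ord -[b *+ _]mulr_natl natrM expr2.
rewrite frob2E; apply: ler_sum => -[j l] _; rewrite !mxE/=.
have [lam [lam0 [lam1 E]]] := hL j l.
by apply: (convex_comb_sqr_le (x := fun t => A t j l) lam0 lam1 E) => t; exact: hA.
Qed.

Section BL1Step.
Variables (R : realType) (d n : nat).
Variables (fi : 'I_n -> 'cV[R]_d -> R) (g : 'I_n -> 'cV[R]_d -> 'cV[R]_d).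
Variable hs : 'I_n -> 'cV[R]_d -> 'M[R]_d.
Variables (mu H Rb : R) (xstar : 'cV[R]_d).
Variables (B : 'I_n -> 'I_d -> 'I_d -> 'M[R]_d) (h : 'I_n -> 'M[R]_d -> 'M[R]_d).
Variable proj : 'M[R]_d -> 'M[R]_d.
Hypothesis n_gt0 : (0 < n)%N.
Hypothesis hgrad : forall i, has_grad (fi i) (g i).
Hypothesis hhess : forall i, has_hess (g i) (hs i).
Hypothesis mu_gt0 : 0 < mu.
Hypothesis hconv : strongly_convex mu (favg fi).
Hypothesis hmin : forall x, favg fi xstar <= favg fi x.
Hypothesis hB : forall i, is_coord (B i) (h i).
Hypothesis hHl : forall i x y, opnorm_le (hs i x - hs i y) (H * vnorm (x - y)).
Hypothesis hRbl : forall i j l, Num.sqrt (frob2 (B i j l)) <= Rb.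
Hypothesis hproj : forall A, is_proj_mu mu A (proj A).

Let Lstar i := h i (hs i xstar).

Lemma Hmat_star : Hmat B Lstar = havg hs xstar.
Proof.
rewrite /Hmat /havg; congr (_ *: _); apply: eq_bigr => i _.
by have [<-] := hB i.
Qed.

(* In both branches of the step [x' - xstar] equals
   [(w' - xstar) - invmx P *m gavg g w'], with [w'] the updated anchor. *)
Lemma bl1_step_newton (alpha eta : R) (s : state R d n) Qk Ck xin :
  let s' := bl1_step g hs B h proj alpha eta s Qk Ck xin in
  mu ^+ 2 * sqnorm (st_x s' - xstar) <=
  2 * sqnorm (st_w s' - xstar) *
    (NB B * Rb ^+ 2 * Hcal (st_L s) Lstar + H ^+ 2 * sqnorm (st_w s' - xstar)).
Proof.
rewrite /bl1_step /=.
case: s => [[[[x w] z] L] xi]; rewrite /st_x /st_w /st_z /st_L /st_xi /=.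
set P := proj (Hmat B L); set w' := if xi then z else w.
have [_ [psdP _]] := hproj (Hmat B L).
have uP := psd_ge_unitmx mu_gt0 psdP.
have hg := has_grad_avg hgrad; have hh := has_hess_avg hhess.
have hl := havg_lipschitz n_gt0 hHl.
have -> : z - invmx P *m (if xi then gavg g z else P *m (z - w) + gavg g w) - xstar =
    (w' - xstar) - invmx P *m gavg g w'.
  rewrite addrAC /w'; case: (xi) => //.
  rewrite mulmxDr mulKmx//; move: (invmx P *m gavg g w) => y.
  by apply/matrixP => i j; rewrite !mxE; ring.
apply: (newton_step_bound mu_gt0 psdP (S := havg hs xstar)).
  apply: le_trans (frob2_HmatB_le _ _ n_gt0 hRbl); rewrite Hmat_star.
  apply: proj_mu_nonexpansive (hproj _) _ _; first exact: (hess_symmetric hg hh hl).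
  exact: (hess_psd hg hh hl).
have := grad_taylor hh hl xstar w'.
by rewrite (grad_at_min hg hmin) subr0.
Qed.

Lemma bl1_step_x_le (alpha eta : R) (s : state R d n) Qk Ck xin (theta c : R) :
  let s' := bl1_step g hs B h proj alpha eta s Qk Ck xin in
  0 <= theta -> sqnorm (st_w s' - xstar) <= c ->
  H ^+ 2 * c <= theta * mu ^+ 2 / 4 ->
  NB B * Rb ^+ 2 * Hcal (st_L s) Lstar <= theta * mu ^+ 2 / 16 ->
  sqnorm (st_x s' - xstar) <= theta * c.
Proof.
move=> s' theta0 hw hc hL; have := bl1_step_newton alpha eta s Qk Ck xin.
rewrite -/s'; set X := sqnorm _; set W := sqnorm _ in hw * => key.
have W0 : 0 <= W by exact: sqnorm_ge0.
have mu2 : 0 < mu ^+ 2 by rewrite exprn_gt0.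
have HW : H ^+ 2 * W <= H ^+ 2 * c by rewrite ler_wpM2l ?sqr_ge0.
rewrite -(ler_pM2l mu2); apply: le_trans key _.
apply: (@le_trans _ _ (2 * W * (theta * mu ^+ 2 / 2))).
  by rewrite -/W ler_wpM2l ?mulr_ge0//; have := mulr_ge0 theta0 (ltW mu2); lra.
have -> : 2 * W * (theta * mu ^+ 2 / 2) = mu ^+ 2 * (theta * W) by field.
by rewrite ler_wpM2l ?(ltW mu2)// ler_wpM2l.
Qed.

End BL1Step.

Lemma Hcal_le (R : realType) (d n : nat) (L L' : 'I_n -> 'M[R]_d) (b : R) :
  (0 < n)%N -> (forall i, frob2 (L i - L' i) <= b) -> Hcal L L' <= b.
Proof.
move=> n0 hL; rewrite /Hcal ler_pdivrMl ?ltr0n//.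
rewrite -[X in X%:R * _](card_ord n) mulr_natl -sumr_const.
by apply: ler_sum => i _.
Qed.

Theorem theorem4p11
  (R : realType) (d n : nat) (hn : (0 < n)%N) (hd : (0 < d)%N)
  (fi : 'I_n -> 'cV[R]_d -> R) (g : 'I_n -> 'cV[R]_d -> 'cV[R]_d)
  (hs : 'I_n -> 'cV[R]_d -> 'M[R]_d)
  (hgrad : forall i, has_grad (fi i) (g i))
  (hhess : forall i, has_hess (g i) (hs i))
  (mu : R) (hmu : 0 < mu) (hconv : strongly_convex mu (favg fi))
  (xstar : 'cV[R]_d) (hmin : forall x, favg fi xstar <= favg fi x)
  (B : 'I_n -> 'I_d -> 'I_d -> 'M[R]_d) (h : 'I_n -> 'M[R]_d -> 'M[R]_d)
  (hB : forall i, is_coord (B i) (h i))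
  (H H1 M1 M2 Rb : R) (hH : 0 < H) (hM1 : 0 < M1) (hM2 : 0 < M2) (hRb : 0 < Rb)
  (hHl : forall i x y, opnorm_le (hs i x - hs i y) (H * vnorm (x - y)))
  (hH1 : forall i x y, Num.sqrt (frob2 (hs i x - hs i y)) <= H1 * vnorm (x - y))
  (hM1l : forall i x y,
     Num.sqrt (frob2 (h i (hs i x) - h i (hs i y))) <= M1 * vnorm (x - y))
  (hM2l : forall i x y (j l : 'I_d),
     `|h i (hs i x) j l - h i (hs i y) j l| <= M2 * vnorm (x - y))
  (hRbl : forall i (j l : 'I_d), Num.sqrt (frob2 (B i j l)) <= Rb)
  (proj : 'M[R]_d -> 'M[R]_d) (hproj : forall A, is_proj_mu mu A (proj A))
  (dO : measure_display) (Omega : measurableType dO) (P : probability Omega R) :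
  let Lstar := fun i => h i (hs i xstar) in
  let NBv := NB B in
  (* part (i) *)
  (forall (alpha eta p omegaM : R) (x0 : 'cV[R]_d) (L0 : 'I_n -> 'M[R]_d)
     (Q : nat -> Omega -> 'cV[R]_d -> 'cV[R]_d)
     (C : nat -> 'I_n -> Omega -> 'M[R]_d -> 'M[R]_d)
     (xi : nat -> Omega -> bool),
     0 <= alpha -> 0 < p <= 1 -> 0 <= omegaM ->
     0 < eta <= (omegaM + 1)^-1 ->
     (forall k, measurable [set w | xi k w] /\ P [set w | xi k w] = p%:E) ->
     (forall k (v : 'cV[R]_d) (j : 'I_d),
        P.-integrable setT (fun w => ((Q k w v) j 0)%:E) /\
        (\int[P]_w ((Q k w v) j 0)%:E = (v j 0)%:E)%E) ->
     (forall k (v : 'cV[R]_d),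
        (\int[P]_w (sqnorm (Q k w v))%:E <= ((omegaM + 1) * sqnorm v)%:E)%E) ->
     let traj := fun w k =>
       bl1 g hs B h proj alpha eta x0 L0 (fun t => Q t w) (fun t i => C t i w)
           (fun t => xi t w) k in
     (forall w k (j : 'I_d), exists lam : nat -> R,
        (forall t, 0 <= lam t) /\ \sum_(t < k.+1) lam t = 1 /\
        (st_z (traj w k)) j 0 = \sum_(t < k.+1) lam t * (st_x (traj w t)) j 0) ->
     (forall w k i (j l : 'I_d), exists lam : nat -> R,
        (forall t, 0 <= lam t) /\ \sum_(t < k.+1) lam t = 1 /\
        (st_L (traj w k)) i j l =
          \sum_(t < k.+1) lam t * h i (hs i (st_z (traj w t))) j l) ->
     let c1 := Num.min (mu ^+ 2 / (4 * d%:R ^+ 2 * H ^+ 2))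
                       (mu ^+ 2 / (16 * d%:R ^+ 4 * NBv * Rb ^+ 2 * M2 ^+ 2)) in
     sqnorm (x0 - xstar) <= c1 ->
     forall w k,
       sqnorm (st_z (traj w k) - xstar) <= d%:R * c1 /\
       Hcal (st_L (traj w k)) Lstar <= mu ^+ 2 / (16 * d%:R * NBv * Rb ^+ 2))
  /\
  (* part (ii) *)
  (forall (p deltaM delta : R) (x0 : 'cV[R]_d) (L0 : 'I_n -> 'M[R]_d)
     (Q : nat -> 'cV[R]_d -> 'cV[R]_d) (C : nat -> 'I_n -> 'M[R]_d -> 'M[R]_d)
     (xi : nat -> Omega -> bool),
     0 < p <= 1 ->
     (forall k, measurable [set w | xi k w] /\ P [set w | xi k w] = p%:E) ->
     0 < deltaM <= 1 -> 0 < delta <= 1 ->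
     (forall k (v : 'cV[R]_d), sqnorm (v - Q k v) <= (1 - deltaM) * sqnorm v) ->
     (forall k i (A : 'M[R]_d), frob2 (A - C k i A) <= (1 - delta) * frob2 A) ->
     let AM := deltaM / 4 in let BM := 6 / deltaM - 7 / 2 in
     let A := delta / 4 in let Bc := 6 / delta - 7 / 2 in
     let c2 := Num.min (AM * mu ^+ 2 / (4 * H ^+ 2 * BM))
                       (A * AM * mu ^+ 2 / (16 * NBv * Rb ^+ 2 * BM * Bc * M1 ^+ 2)) in
     let traj := fun w k => bl1 g hs B h proj 1 1 x0 L0 Q C (fun t => xi t w) k in
     sqnorm (x0 - xstar) <= c2 ->
     Hcal L0 Lstar <= AM * mu ^+ 2 / (16 * NBv * Rb ^+ 2 * BM) ->
     forall w k,
       sqnorm (st_z (traj w k) - xstar) <= c2 /\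
       Hcal (st_L (traj w k)) Lstar <= AM * mu ^+ 2 / (16 * NBv * Rb ^+ 2 * BM)).
Proof.
move=> Lstar NBv.
have eqle (a b : R) : a = b -> a <= b by move=> ->.
have NB0 : 0 < NBv by exact: NB_gt0.
have dR : 1 <= d%:R :> R by rewrite ler1n.
have d0 : 0 < d%:R :> R by rewrite ltr0n.
have Rb2 : 0 < Rb ^+ 2 by rewrite exprn_gt0.
have mu2 : 0 < mu ^+ 2 by rewrite exprn_gt0.
have H2 : 0 < H ^+ 2 by rewrite exprn_gt0.
have M12 : 0 < M1 ^+ 2 by rewrite exprn_gt0.
have M22 : 0 < M2 ^+ 2 by rewrite exprn_gt0.
have step := bl1_step_x_le hn hgrad hhess hmu hconv hmin hB hHl hRbl hproj.
split.
  move=> alpha eta p omegaM x0 L0 Q C xi _ _ _ _ _ _ _ traj hz hL c1 hx0 w.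
  have c1H : c1 <= mu ^+ 2 / (4 * d%:R ^+ 2 * H ^+ 2) by rewrite ge_min lexx.
  have c1M : c1 <= mu ^+ 2 / (16 * d%:R ^+ 4 * NBv * Rb ^+ 2 * M2 ^+ 2).
    by rewrite ge_min lexx orbT.
  have c10 : 0 <= c1 by exact: le_trans (sqnorm_ge0 _) hx0.
  have zb k : (forall t, (t <= k)%N -> sqnorm (st_x (traj w t) - xstar) <= c1) ->
      sqnorm (st_z (traj w k) - xstar) <= d%:R * c1.
    by move=> hx; apply: sqnorm_convex_comb hx => j; exact: hz.
  have Lb k : (forall t, (t <= k)%N -> sqnorm (st_z (traj w t) - xstar) <= d%:R * c1) ->
      Hcal (st_L (traj w k)) Lstar <= mu ^+ 2 / (16 * d%:R * NBv * Rb ^+ 2).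
    move=> hzk; apply: Hcal_le => // i.
    apply: (@le_trans _ _ (d%:R ^+ 2 * (M2 ^+ 2 * (d%:R * c1)))).
      apply: (frob2_convex_comb (A := fun t => h i (hs i (st_z (traj w t))))).
        by move=> j l; exact: hL.
      move=> t j l tk; apply: (@le_trans _ _ (M2 ^+ 2 * sqnorm (st_z (traj w t) - xstar))).
        rewrite -sqr_vnorm -exprMn -[leLHS]real_normK ?num_real//.
        by rewrite ler_pXn2r ?nnegrE ?mulr_ge0 ?vnorm_ge0 ?(ltW hM2)//; exact: hM2l.
      by rewrite ler_wpM2l ?(ltW M22)// hzk.
    apply: (@le_trans _ _ (d%:R ^+ 3 * M2 ^+ 2 *
        (mu ^+ 2 / (16 * d%:R ^+ 4 * NBv * Rb ^+ 2 * M2 ^+ 2)))).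
      rewrite (_ : d%:R ^+ 2 * _ = d%:R ^+ 3 * M2 ^+ 2 * c1); last by ring.
      by rewrite ler_wpM2l// mulr_ge0 ?(ltW M22)// exprn_ge0// ltW.
    by apply: eqle; field; rewrite !gt_eqF.
  have xb k : (forall t, (t <= k)%N -> sqnorm (st_x (traj w t) - xstar) <= c1) /\
      sqnorm (st_w (traj w k) - xstar) <= d%:R * c1.
    elim: k => [|k [IHx IHw]].
      split; first by move=> t; rewrite leqn0 => /eqP ->.
      by apply: le_trans hx0 _; rewrite ler_peMl.
    have zk t : (t <= k)%N -> sqnorm (st_z (traj w t) - xstar) <= d%:R * c1.
      by move=> tk; apply: zb => t' tt'; apply: IHx; exact: leq_trans tk.
    have wk : sqnorm (st_w (traj w k.+1) - xstar) <= d%:R * c1.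
      by rewrite /traj/= /bl1_step/= {1}/st_w/=; case: ifP => _ //; exact: zk.
    split => // t; rewrite leq_eqVlt => /predU1P[->|]; last by rewrite ltnS; exact: IHx.
    have -> : c1 = d%:R^-1 * (d%:R * c1) by rewrite mulKf// gt_eqF.
    apply: step => //.
      apply: le_trans (ler_wpM2l (ltW H2) (ler_wpM2l (ltW d0) c1H)) _.
      by apply: eqle; field; rewrite !gt_eqF.
    have NR : 0 <= NB B * Rb ^+ 2 by rewrite mulr_ge0 ?ltW.
    apply: le_trans (ler_wpM2l NR (Lb k zk)) _.
    by apply: eqle; rewrite -/NBv; field; rewrite !gt_eqF.
  move=> k; have [xk _] := xb k; split; first exact: zb.
  by apply: Lb => t tk; apply: zb => t' tt'; apply: xk; exact: leq_trans tk.
move=> p deltaM delta x0 L0 Q C xi _ _ hdM hdl hQ hC AM BM A Bc c2 traj hx0 hL0 w.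
have /andP[dM0 dM1] := hdM; have /andP[dl0 dl1] := hdl.
have BM0 : 0 < BM by rewrite subr_gt0 ltr_pdivlMr//; lra.
have Bc0 : 0 < Bc by rewrite subr_gt0 ltr_pdivlMr//; lra.
have AM0 : 0 < AM by rewrite divr_gt0.
have A0 : 0 < A by rewrite divr_gt0.
have c2H : c2 <= AM * mu ^+ 2 / (4 * H ^+ 2 * BM) by rewrite ge_min lexx.
have c2M : c2 <= A * AM * mu ^+ 2 / (16 * NBv * Rb ^+ 2 * BM * Bc * M1 ^+ 2).
  by rewrite ge_min lexx orbT.
set hL := AM * mu ^+ 2 / (16 * NBv * Rb ^+ 2 * BM) in hL0 *.
suff inv k : [/\ sqnorm (st_z (traj w k) - xstar) <= c2,
    sqnorm (st_w (traj w k) - xstar) <= c2 & Hcal (st_L (traj w k)) Lstar <= hL].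
  by move=> k; have [] := inv k.
elim: k => [//|k [IHz IHw IHL]].
have wk : sqnorm (st_w (traj w k.+1) - xstar) <= c2.
  by rewrite /traj/= /bl1_step/= {1}/st_w/=; case: ifP.
have xk : sqnorm (st_x (traj w k.+1) - xstar) <= AM / BM * c2.
  apply: step => //; first by rewrite divr_ge0 ?ltW.
    apply: le_trans (ler_wpM2l (ltW H2) c2H) _.
    by apply: eqle; field; rewrite !gt_eqF.
  have NR : 0 <= NB B * Rb ^+ 2 by rewrite mulr_ge0 ?ltW.
  apply: le_trans (ler_wpM2l NR IHL) _.
  by apply: eqle; rewrite /hL -/NBv; field; rewrite !gt_eqF.
split => //.
  set z := st_z (traj w k) in IHz *; set x' := st_x (traj w k.+1) in xk.
  have -> : st_z (traj w k.+1) - xstar =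
      (x' - xstar) - ((x' - z) - Q k (x' - z)).
    have -> : st_z (traj w k.+1) = z + 1 *: Q k (x' - z) by [].
    by rewrite scale1r; apply/matrixP => i j; rewrite !mxE; ring.
  apply: (@le_trans _ _ ((1 - AM) * sqnorm (z - xstar) + BM * sqnorm (x' - xstar))).
    apply: sqnorm_contraction => //; rewrite opprB subrKA; exact: hQ.
  have : BM * sqnorm (x' - xstar) <= AM * c2.
    apply: le_trans (ler_wpM2l (ltW BM0) xk) _.
    by apply: eqle; field; rewrite gt_eqF.
  have : (1 - AM) * sqnorm (z - xstar) <= (1 - AM) * c2.
    by rewrite ler_wpM2l// /AM; lra.
  lra.
set z := st_z (traj w k) in IHz.
have Lk i : frob2 (st_L (traj w k.+1) i - Lstar i) <=
    (1 - A) * frob2 (st_L (traj w k) i - Lstar i) + Bc * (M1 ^+ 2 * c2).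
  set L := st_L (traj w k) i.
  have -> : st_L (traj w k.+1) i - Lstar i = (h i (hs i z) - Lstar i) -
      ((h i (hs i z) - L) - C k i (h i (hs i z) - L)).
    have -> : st_L (traj w k.+1) i = L + 1 *: C k i (h i (hs i z) - L) by [].
    by rewrite scale1r; apply/matrixP => a b; rewrite !mxE; ring.
  apply: (@le_trans _ _ ((1 - A) * frob2 (L - Lstar i)
      + Bc * frob2 (h i (hs i z) - Lstar i))).
    apply: frob2_contraction => //; rewrite opprB subrKA; exact: hC.
  rewrite lerD2l ler_wpM2l ?(ltW Bc0)//.
  apply: le_trans (frob2_le_of_sqrt (hM1l i z xstar)) _.
  by rewrite exprMn sqr_vnorm ler_wpM2l ?(ltW M12).
have HL : Hcal (st_L (traj w k.+1)) Lstar <=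
    (1 - A) * Hcal (st_L (traj w k)) Lstar + Bc * (M1 ^+ 2 * c2).
  rewrite /Hcal ler_pdivrMl ?ltr0n// mulrDr mulrCA mulVKf ?gt_eqF ?ltr0n//.
  rewrite -[X in _ + X%:R * _](card_ord n) mulr_natl -sumr_const mulr_sumr -big_split/=.
  by apply: ler_sum => i _; exact: Lk.
apply: le_trans HL _.
have : (1 - A) * Hcal (st_L (traj w k)) Lstar <= (1 - A) * hL.
  by rewrite ler_wpM2l// /A; lra.
have : Bc * (M1 ^+ 2 * c2) <= A * hL.
  apply: le_trans (ler_wpM2l (ltW Bc0) (ler_wpM2l (ltW M12) c2M)) _.
  by apply: eqle; rewrite /hL; field; rewrite !gt_eqF.
lra.
Qed.
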